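(* Let $n,w,r$ be integers such that $n\ge 2$, $2\le 2w\le n-1$ and $0\le r\le w$. Let $\mathrm{INF}_r\subset \mathrm{PENCIL}^{ss}_{n\times n}$ be the set of all $n\times n$ complex skew-symmetric matrix pencils having exactly $r$ $\mathcal K$-blocks (the blocks corresponding to the infinite eigenvalue) in their skew-symmetric Kronecker canonical form. Then the set of $n\times n$ complex skew-symmetric matrix pencils with rank at most $2w$ and with exactly $r$ $\mathcal K$-blocks in the skew-symmetric Kronecker canonical form is a closed subset of $\mathrm{INF}_r$ (in the subspace topology) equal to $\overline{\mathrm{O}^c}(\mathcal W)\cap \mathrm{INF}_r$, where $$\mathcal W=\operatorname{diag}(\underbrace{\mathcal M_{\alpha+1},\dots,\mathcal M_{\alpha+1}}_{s},\underbrace{\mathcal M_{\alpha},\dots,\mathcal M_{\alpha}}_{n-2w-s},\underbrace{\mathcal K_1,\dots,\mathcal K_1}_{r}),$$ with $\alpha=\lfloor (w-r)/(n-2w)\rfloor$ and $s$ the remainder of $w-r$ modulo $n-2w$, i.e. $s\equiv w-r \pmod{n-2w}$ with $0\le s<n-2w$.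
   Context: A matrix pencil is $\lambda A-B$ with $A,B$ complex matrices of the same size; it is skew-symmetric if $A^T=-A$ and $B^T=-B$. $\mathrm{PENCIL}^{ss}_{n\times n}$ is the vector space of $n\times n$ complex skew-symmetric pencils, with the topology induced by the distance $d(\lambda A-B,\lambda C-D)=\sqrt{\|A-C\|_F^2+\|B-D\|_F^2}$ ($\|\cdot\|_F$ the Frobenius norm). The rank of a pencil is the largest size of a minor that is not identically zero as a polynomial in $\lambda$. The congruence orbit of a skew-symmetric pencil is $\mathrm{O}^c(\lambda A-B)=\{S^T(\lambda A-B)S: S\in GL_n(\mathbb C)\}$, and $\overline{\mathrm{O}^c}(\lambda A-B)$ is its closure in $\mathrm{PENCIL}^{ss}_{n\times n}$. Let $J_k(\mu)$ be the $k\times k$ upper triangular Jordan block with $\mu$ on the diagonal and $1$ on the first superdiagonal, $I_k$ the identity, and for $k\ge 0$ let $F_k$, $G_k$ be the $k\times(k+1)$ matrices $F_k=[\,0\;\; I_k\,]$ and $G_k=[\,I_k\;\; 0\,]$ (with one zero column). Define $$\mathcal H_h(\mu)=\lambda\begin{bmatrix}0&I_h\\-I_h&0\end{bmatrix}-\begin{bmatrix}0&J_h(\mu)\\-J_h(\mu)^T&0\end{bmatrix}\ (\mu\in\mathbb C),$$ $$\mathcal K_k=\lambda\begin{bmatrix}0&J_k(0)\\-J_k(0)^T&0\end{bmatrix}-\begin{bmatrix}0&I_k\\-I_k&0\end{bmatrix},\qquad \mathcal M_k=\lambda\begin{bmatrix}0&G_k\\-G_k^T&0\end{bmatrix}-\begin{bmatrix}0&F_k\\-F_k^T&0\end{bmatrix},$$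 with $h\ge1$, $k\ge 1$ for $\mathcal H_h(\mu)$ and $\mathcal K_k$, and $k\ge 0$ for $\mathcal M_k$ ($\mathcal M_0$ is the $1\times1$ zero pencil). Every skew-symmetric pencil is congruent (via $S^T(\cdot)S$, $S$ nonsingular constant) to a direct sum of such blocks, unique up to permutation of summands; this is its skew-symmetric Kronecker canonical form. The number of $\mathcal K$-blocks of a skew-symmetric pencil is the number of summands of the form $\mathcal K_k$ (any $k\geq 1$) in this form. *)

(* Defs.v *)
From HB Require Import structures.
From mathcomp Require Import all_boot all_order all_algebra.
From mathcomp Require Import complex.
From mathcomp Require Import all_classical all_reals all_analysis.
From mathcomp Require Import zify ring.

Set Implicit Arguments.
Unset Strict Implicit.
Unset Printing Implicit Defensive.

Import Order.TTheory GRing.Theory Num.Theory.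
Import Normc.

Local Open Scope complex_scope.
Local Open Scope classical_set_scope.
Local Open Scope ring_scope.

Section SkewPencil.
Context {R : realType}.
Local Notation C := R[i].

Definition is_skew n (A : 'M[C]_n) : bool := A^T == - A.

(* The pair (A, B) stands for the pencil lambda A - B. *)
Record skew_pencil n := SkewPencil {
  pencil_val :> 'M[C]_n * 'M[C]_n;
  pencil_skew : is_skew pencil_val.1 && is_skew pencil_val.2 }.

HB.instance Definition _ n := [isSub for @pencil_val n].
HB.instance Definition _ n := [Choice of skew_pencil n by <:].

Definition frobenius m n (A : 'M[C]_(m, n)) : R :=
  Num.sqrt (\sum_i \sum_j normc (A i j) ^+ 2).

Definition pencil_dist n (P Q : skew_pencil n) : R :=
  Num.sqrt (frobenius (P.1 - Q.1) ^+ 2 + frobenius (P.2 - Q.2) ^+ 2).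

Lemma frobenius_ge0 m n (A : 'M[C]_(m, n)) : 0 <= frobenius A.
Proof. exact: sqrtr_ge0. Qed.

Lemma frobenius0 m n : frobenius (0 : 'M[C]_(m, n)) = 0.
Proof.
rewrite /frobenius big1 ?sqrtr0 // => i _; rewrite big1 // => j _.
by rewrite mxE normc0 expr0n.
Qed.

Lemma frobeniusN m n (A : 'M[C]_(m, n)) : frobenius (- A) = frobenius A.
Proof.
by congr Num.sqrt; do 2![apply: eq_bigr => ? _]; rewrite mxE normcN.
Qed.

Lemma frobenius_eq0 m n (A : 'M[C]_(m, n)) : frobenius A = 0 -> A = 0.
Proof.
move/eqP; rewrite sqrtr_eq0 => A_le0.
have ge0 i : 0 <= \sum_j normc (A i j) ^+ 2.
  by apply: sumr_ge0 => j _; exact: sqr_ge0.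
have /eqP : \sum_i \sum_j normc (A i j) ^+ 2 = 0.
  by apply/eqP; rewrite eq_le A_le0 sumr_ge0.
rewrite psumr_eq0 => [/allP A0|i _]; last exact: ge0.
apply/matrixP => i j; rewrite mxE.
have := A0 i (mem_index_enum _); rewrite psumr_eq0 => [/allP Ai0|k _]; last exact: sqr_ge0.
have := Ai0 j (mem_index_enum _); rewrite sqrf_eq0 => /eqP.
exact: eq0_normc.
Qed.

Lemma l2_CauchySchwarz (I : finType) (x y : I -> R) :
  (\sum_i x i * y i) ^+ 2 <= (\sum_i x i ^+ 2) * (\sum_i y i ^+ 2).
Proof.
set c := \sum_i x i * y i; set A := \sum_i x i ^+ 2; set B := \sum_i y i ^+ 2.
have B_ge0 : 0 <= B by apply: sumr_ge0 => i _; exact: sqr_ge0.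
have [B0|B_neq0] := eqVneq B 0.
  suff -> : c = 0 by rewrite B0 mulr0 expr0n.
  apply: big1 => i _; move/eqP: B0.
  rewrite psumr_eq0 => [/allP y0|j _]; last exact: sqr_ge0.
  have := y0 i (mem_index_enum _); rewrite sqrf_eq0 => /eqP ->.
  by rewrite mulr0.
have B_gt0 : 0 < B by rewrite lt_def B_neq0.
rewrite -subr_ge0 -(pmulr_rge0 _ B_gt0).
suff -> : B * (A * B - c ^+ 2) = \sum_i (B * x i - c * y i) ^+ 2.
  by apply: sumr_ge0 => i _; exact: sqr_ge0.
transitivity (\sum_i (B ^+ 2 * x i ^+ 2 + (- (2 * B * c)) * (x i * y i)
                      + c ^+ 2 * y i ^+ 2)).
  by rewrite !big_split /= -!mulr_sumr -/A -/B -/c; ring.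
by apply: eq_bigr => i _; ring.
Qed.

Lemma l2_triangle (I : finType) (x y : I -> R) :
  Num.sqrt (\sum_i (x i + y i) ^+ 2) <=
  Num.sqrt (\sum_i x i ^+ 2) + Num.sqrt (\sum_i y i ^+ 2).
Proof.
have ge0 (z : I -> R) : 0 <= \sum_i z i ^+ 2.
  by apply: sumr_ge0 => i _; exact: sqr_ge0.
rewrite -(@ler_pXn2r _ 2) ?nnegrE ?sqrtr_ge0 ?addr_ge0 ?sqrtr_ge0 //.
rewrite sqrrD !sqr_sqrtr //.
have -> : \sum_i (x i + y i) ^+ 2 =
    \sum_i x i ^+ 2 + (\sum_i x i * y i) *+ 2 + \sum_i y i ^+ 2.
  by rewrite -sumrMnl -!big_split /=; apply: eq_bigr => i _; rewrite sqrrD.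
rewrite lerD2r lerD2l lerMn2r /= -sqrtrM //.
rewrite (le_trans (ler_norm _)) // -sqrtr_sqr ler_wsqrtr //.
exact: l2_CauchySchwarz.
Qed.

Lemma frobenius_triangle m n (A B : 'M[C]_(m, n)) :
  frobenius (A + B) <= frobenius A + frobenius B.
Proof.
rewrite /frobenius !pair_bigA /=.
apply: le_trans (l2_triangle _ _); rewrite ler_wsqrtr //.
apply: ler_sum => -[i j] _ /=; rewrite mxE ler_pXn2r ?nnegrE //.
- exact: le_normcD.
- by case: (A i j + B i j) => a b; exact: sqrtr_ge0.
- by case: (A i j) => a b; case: (B i j) => a' b'; rewrite addr_ge0 ?sqrtr_ge0.
Qed.

Lemma pencil_distxx n (P : skew_pencil n) : pencil_dist P P = 0.
Proof. by rewrite /pencil_dist !subrr frobenius0 expr0n addr0 sqrtr0. Qed.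

Lemma pencil_dist_eq0 n (P Q : skew_pencil n) : pencil_dist P Q = 0 -> P = Q.
Proof.
move/eqP; rewrite sqrtr_eq0 => le0; apply: val_inj.
have /eqP : frobenius (P.1 - Q.1) ^+ 2 + frobenius (P.2 - Q.2) ^+ 2 = 0.
  by apply/eqP; rewrite eq_le le0 addr_ge0 ?sqr_ge0.
rewrite paddr_eq0 ?sqr_ge0 // !sqrf_eq0 => /andP[/eqP/frobenius_eq0 e1].
move=> /eqP/frobenius_eq0 e2; rewrite /= [LHS]surjective_pairing.
by rewrite [RHS]surjective_pairing (subr0_eq e1) (subr0_eq e2).
Qed.

Lemma pencil_dist_sym n (P Q : skew_pencil n) :
  pencil_dist P Q = pencil_dist Q P.
Proof.
by rewrite /pencil_dist -frobeniusN opprB -[frobenius (P.2 - _)]frobeniusN opprB.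
Qed.

Lemma pencil_dist_triangle n (Q P T : skew_pencil n) :
  pencil_dist P T <= pencil_dist P Q + pencil_dist Q T.
Proof.
pose f (U V : skew_pencil n) b :=
  if b then frobenius (U.1 - V.1) else frobenius (U.2 - V.2).
have distE U V : pencil_dist U V = Num.sqrt (\sum_b f U V b ^+ 2).
  by rewrite big_bool.
rewrite !distE; apply: le_trans (l2_triangle _ _); rewrite ler_wsqrtr //.
have f_ge0 U V b : 0 <= f U V b by case: b; exact: frobenius_ge0.
apply: ler_sum => b _; rewrite ler_pXn2r ?nnegrE ?addr_ge0 //.
case: b; rewrite /f.
  by rewrite -[P.1 - T.1](subrKA Q.1); exact: frobenius_triangle.
by rewrite -[P.2 - T.2](subrKA Q.2); exact: frobenius_triangle.
Qed.

HB.instance Definition _ n := isMetric.Build R (skew_pencil n)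
  (@pencil_distxx n) (@pencil_dist_eq0 n) (@pencil_dist_sym n)
  (@pencil_dist_triangle n).

Definition pencil_polymx n (P : skew_pencil n) : 'M[{poly C}]_n :=
  'X *: map_mx polyC P.1 - map_mx polyC P.2.

(* A k x k submatrix is selected by its row indices f and column indices g.
   They need not be increasing: other choices only give 0 or, up to sign, a
   minor with increasing indices. *)
Definition has_nonzero_minor n (P : skew_pencil n) (k : nat) : bool :=
  [exists f : {ffun 'I_k -> 'I_n}, exists g : {ffun 'I_k -> 'I_n},
    \det (mxsub f g (pencil_polymx P)) != 0].

Definition pencil_rank n (P : skew_pencil n) : nat :=
  \max_(k < n.+1 | has_nonzero_minor P k) k.

Lemma congr_skew n (S : 'M[C]_n) (P : skew_pencil n) :
  is_skew (S^T *m P.1 *m S) && is_skew (S^T *m P.2 *m S).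
Proof.
case: P => -[A B] /= /andP[/eqP hA /eqP hB]; rewrite /is_skew.
by rewrite !trmx_mul !trmxK hA hB !mulNmx !mulmxN mulmxA mulmxA !eqxx.
Qed.

Definition congr_pencil n (S : 'M[C]_n) (P : skew_pencil n) : skew_pencil n :=
  @SkewPencil n (S^T *m P.1 *m S, S^T *m P.2 *m S) (congr_skew S P).

Definition congr_orbit n (P : skew_pencil n) : set (skew_pencil n) :=
  [set Q | exists2 S : 'M[C]_n, S \in unitmx & Q = congr_pencil S P].

Lemma zero_skew n : is_skew (0 : 'M[C]_n) && is_skew (0 : 'M[C]_n).
Proof. by rewrite /is_skew trmx0 oppr0 eqxx. Qed.

Definition zero_pencil n : skew_pencil n := @SkewPencil n (0, 0) (zero_skew n).

Lemma dsum_skew m n (P : skew_pencil m) (Q : skew_pencil n) :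
  is_skew (block_mx P.1 0 0 Q.1) && is_skew (block_mx P.2 0 0 Q.2).
Proof.
case: P Q => -[A B] /= /andP[/eqP hA /eqP hB].
case=> -[A' B'] /= /andP[/eqP hA' /eqP hB'].
by rewrite /is_skew !tr_block_mx !trmx0 !opp_block_mx !oppr0 hA hB hA' hB' !eqxx.
Qed.

Definition dsum_pencil m n (P : skew_pencil m) (Q : skew_pencil n) :
    skew_pencil (m + n) :=
  @SkewPencil (m + n) (block_mx P.1 0 0 Q.1, block_mx P.2 0 0 Q.2)
    (dsum_skew P Q).

Definition skew_block m n (X : 'M[C]_(m, n)) : 'M[C]_(m + n) :=
  block_mx 0 X (- X^T) 0.

Lemma skew_block_skew m n (X Y : 'M[C]_(m, n)) :
  is_skew (skew_block X) && is_skew (skew_block Y).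
Proof.
rewrite /is_skew /skew_block !tr_block_mx !opp_block_mx.
by rewrite !linearN /= !trmxK !trmx0 !oppr0 !opprK !eqxx.
Qed.

Definition block_pencil m n (X Y : 'M[C]_(m, n)) : skew_pencil (m + n) :=
  @SkewPencil (m + n) (skew_block X, skew_block Y) (skew_block_skew X Y).

Definition jordan_block k (mu : C) : 'M[C]_k :=
  \matrix_(i < k, j < k)
    (if i == j then mu else if (j == i.+1 :> nat) then 1 else 0).

(* F_k = [0 I_k] and G_k = [I_k 0], as k x (k + 1) matrices. *)
Definition F_mx k : 'M[C]_(k, k.+1) :=
  \matrix_(i < k, j < k.+1) (j == i.+1 :> nat)%:R.
Definition G_mx k : 'M[C]_(k, k.+1) :=
  \matrix_(i < k, j < k.+1) (j == i :> nat)%:R.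

Definition H_pencil h (mu : C) : skew_pencil (h + h) :=
  block_pencil 1%:M (jordan_block h mu).
Definition K_pencil k : skew_pencil (k + k) :=
  block_pencil (jordan_block k 0) 1%:M.
Definition M_pencil k : skew_pencil (k + k.+1) :=
  block_pencil (G_mx k) (F_mx k).

Inductive skblock := Hblk of nat & C | Kblk of nat | Mblk of nat.

Definition skblock_valid (b : skblock) : bool :=
  match b with Hblk h _ => 0 < h | Kblk k => 0 < k | Mblk _ => true end%N.

Definition is_Kblk (b : skblock) : bool := if b is Kblk _ then true else false.

Definition skblock_dim (b : skblock) : nat :=
  match b with Hblk h _ => h + h | Kblk k => k + k | Mblk k => k + k.+1 end%N.

Definition skblock_pencil (b : skblock) : skew_pencil (skblock_dim b) :=
  match b return skew_pencil (skblock_dim b) with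
  | Hblk h mu => H_pencil h mu
  | Kblk k => K_pencil k
  | Mblk k => M_pencil k
  end.

Fixpoint diag_dim (bs : seq skblock) : nat :=
  if bs is b :: bs' then (skblock_dim b + diag_dim bs')%N else 0%N.

Fixpoint diag_pencil (bs : seq skblock) : skew_pencil (diag_dim bs) :=
  match bs return skew_pencil (diag_dim bs) with
  | [::] => zero_pencil 0
  | b :: bs' => dsum_pencil (skblock_pencil b) (diag_pencil bs')
  end.

Definition cast_pencil m n (e : m = n) (P : skew_pencil m) : skew_pencil n :=
  ecast k (skew_pencil k) e P.

Definition is_skew_kcf n (P : skew_pencil n) (bs : seq skblock) : Prop :=
  all skblock_valid bs /\
  exists e : diag_dim bs = n, congr_orbit (cast_pencil e (diag_pencil bs)) P.

(* The canonical form is unique up to the order of its blocks, so "some"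
   canonical form of P is "the" canonical form of P. *)
Definition INF n (r : nat) : set (skew_pencil n) :=
  [set P | exists2 bs, is_skew_kcf P bs & count is_Kblk bs = r].

Definition W_blocks (n w r : nat) : seq skblock :=
  let alpha := ((w - r) %/ (n - 2 * w))%N in
  let s := ((w - r) %% (n - 2 * w))%N in
  nseq s (Mblk alpha.+1) ++ nseq (n - 2 * w - s)%N (Mblk alpha)
    ++ nseq r (Kblk 1).

Lemma diag_dim_cat bs bs' :
  diag_dim (bs ++ bs') = (diag_dim bs + diag_dim bs')%N.
Proof. by elim: bs => //= b bs ->; rewrite addnA. Qed.

Lemma diag_dim_nseq k b : diag_dim (nseq k b) = (k * skblock_dim b)%N.
Proof. by elim: k => //= k ->; rewrite mulSn. Qed.

Lemma W_dim n w r (hw : (2 <= 2 * w <= n - 1)%N) (hr : (r <= w)%N) :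
  diag_dim (W_blocks n w r) = n.
Proof.
rewrite /W_blocks !diag_dim_cat !diag_dim_nseq /=.
have d_gt0 : (0 < n - 2 * w)%N by lia.
have := divn_eq (w - r) (n - 2 * w); have := ltn_pmod (w - r) d_gt0.
by move: (_ %/ _)%N (_ %% _)%N => a s; nia.
Qed.

Definition W_pencil n w r (hw : (2 <= 2 * w <= n - 1)%N) (hr : (r <= w)%N) :
    skew_pencil n :=
  cast_pencil (W_dim hw hr) (diag_pencil (W_blocks n w r)).

End SkewPencil.

Arguments skew_pencil R n : clear implicits.
Arguments INF R n r : clear implicits.
Arguments W_pencil R [n w r] hw hr.

(* Main.v *)
From HB Require Import structures.
Require Import Defs.
From mathcomp Require Import all_boot all_order all_algebra.
From mathcomp Require Import complex.
From mathcomp Require Import all_classical all_reals all_analysis.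
From mathcomp Require Import zify.

(** Write a pencil [lambda A - B] as its pair of coefficients, and call [P] a
degeneration of [Q] when [P] is a limit of pencils [S^T Q S], where [S] is an
arbitrary, possibly rectangular or singular, matrix.  Invertible matrices are
dense, so for pencils of the same size this says exactly that [P] lies in the
closure of the orbit of [Q] ([closure_orbitP]).  Allowing every [S] makes the
relation a preorder that is compatible with direct sums and that contains
every reordering of rows and columns, whatever the way the sizes are written.

Evaluating at a number [x] turns a pencil into a matrix whose rank can only
drop under degeneration ([degen_rank]).  As the pencil [W] has rank at most
[2w] at every [x], so has each pencil in the closure of its orbit.

Conversely, let [P] have rank at most [2w] and exactly [r] K-blocks.  Away from
the finite eigenvalues of [P], its rank is [n] minus the number of its
M-blocks, so [P] has at least [n - 2w] of them; in particular it has one.  The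
following degenerations then lead from the canonical form of [P] to [W]
([degen_W_blocks]); each line says that the left side is a degeneration of the
right side.
- [M_k + H_h(mu)] of [M_(k+h)]: an M-block absorbs every H-block ([degen_MH]);
- [M_k + K_(j+1)] of [K_1 + M_(k+j)]: the K-blocks shrink to [K_1] while their
  number stays the same ([degen_MK]);
- [M_a + M_b] of [H_(a+b+1)(0)]: together with the first line this merges three
  M-blocks into one, and the number of M-blocks has the parity of [n]
  ([degen_MM_H]);
- [M_a + M_(c+1)] of [M_c + M_(a+1)] for [a <= c]: the sizes of the M-blocks
  become balanced ([degen_MM]).

All blocks have the form [[0, X], [-X^T, 0]], which reduces these four facts to
rectangular pencils [X].  There a pencil [[X, 0], [x, Z]] degenerates to the
direct sum of [X] and [Z], by letting a diagonal scaling act on [x]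
([degen_lower_glue]), and a pair of constant matrices intertwining [X] and [Y]
moves a block [Z] attached to [Y] over to [X] ([degen_transplant]). *)

Set Implicit Arguments.
Unset Strict Implicit.
Unset Printing Implicit Defensive.

Import Order.TTheory GRing.Theory Num.Theory.
Import Normc.
Local Open Scope complex_scope.
Local Open Scope classical_set_scope.
Local Open Scope ring_scope.

(** * Limits of congruence orbits *)

Lemma splitKl m n (i : 'I_m) : fintype.split (lshift n i) = inl i.
Proof. exact: (unsplitK (inl i)). Qed.

Lemma splitKr m n (i : 'I_n) : fintype.split (rshift m i) = inr i.
Proof. exact: (unsplitK (inr i)). Qed.

Section Degeneration.
Variable C : numFieldType.
(* [P true] and [P false] stand for [A] and [B] in [lambda A - B]: a statement
   on both coefficients becomes one statement on [P b]. *)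
Local Notation pencil m n := (bool -> 'M[C]_(m, n)).

(** The sizes of [P] and [Q] are independent and [S] need not be invertible, so
    that a relation between block sums never involves a cast between sizes. *)
Definition degen m n (P : pencil m m) (Q : pencil n n) :=
  forall e : C, 0 < e ->
    exists S : 'M[C]_(n, m), forall b i j, `|(P b - S^T *m Q b *m S) i j| < e.

Definition dsum m n p q (P : pencil m n) (Q : pencil p q) : pencil (m + p) (n + q) :=
  fun b => block_mx (P b) 0 0 (Q b).

Definition skew_of m n (X : pencil m n) : pencil (m + n) (m + n) :=
  fun b => block_mx 0 (X b) (- (X b)^T) 0.

Lemma degen_congr m n (P : pencil m m) (Q : pencil n n) (S : 'M[C]_(n, m)) :
  (forall b, P b = S^T *m Q b *m S) -> degen P Q.
Proof.
move=> PE e e0; exists S => b i j.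
by rewrite PE subrr mxE normr0.
Qed.

Definition norm1 m n (A : 'M[C]_(m, n)) : C := \sum_i \sum_j `|A i j|.

Lemma norm1_ge0 m n (A : 'M[C]_(m, n)) : 0 <= norm1 A.
Proof. by do 2!apply: sumr_ge0 => ? _. Qed.

Lemma ler_norm1 m n (A : 'M[C]_(m, n)) i j : `|A i j| <= norm1 A.
Proof.
rewrite /norm1 (bigD1 i) //= (bigD1 j) //= -addrA lerDl addr_ge0 //.
  by rewrite sumr_ge0.
by do 2!apply: sumr_ge0 => ? _.
Qed.

Lemma norm1_mulmx_le m n p (A : 'M[C]_(m, n)) (E : 'M[C]_(n, p)) d i j : 0 <= d ->
  (forall i j, `|E i j| <= d) -> `|(A *m E) i j| <= norm1 A * d.
Proof.
move=> d0 Ed; rewrite mxE (le_trans (ler_norm_sum _ _ _)) // /norm1 mulr_suml.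
rewrite [leRHS](bigD1 i) //= -[leLHS]addr0 lerD //.
  by rewrite mulr_suml ler_sum // => k _; rewrite normrM ler_wpM2l.
by apply: sumr_ge0 => k _; rewrite mulr_ge0 // sumr_ge0.
Qed.

Lemma degen_trans m n p (Q : pencil n n) (P : pencil m m) (T : pencil p p) :
  degen P Q -> degen Q T -> degen P T.
Proof.
move=> PQ QT e e0; have e20 : 0 < e / 2 by rewrite divr_gt0.
have [S SP] := PQ _ e20.
pose K := norm1 S^T * norm1 S^T + 1.
have K0 : 0 < K by rewrite ltr_wpDl ?mulr_ge0 ?norm1_ge0.
have [S' S'P] := QT _ (divr_gt0 e20 K0).
exists (S' *m S) => b i j.
have -> : P b - (S' *m S)^T *m T b *m (S' *m S) =
   (P b - S^T *m Q b *m S) + S^T *m (Q b - S'^T *m T b *m S') *m S.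
  by rewrite trmx_mul mulmxBr mulmxBl !mulmxA addrA subrK.
rewrite mxE (le_lt_trans (ler_normD _ _)) // (splitr e) ltr_leD //.
have -> : S^T *m (Q b - S'^T *m T b *m S') *m S =
   (S^T *m (S^T *m (Q b - S'^T *m T b *m S'))^T)^T by rewrite !trmx_mul !trmxK.
set d := e / 2 / K in S'P.
have d0 : 0 <= d by rewrite ltW // divr_gt0.
rewrite mxE; apply: (@le_trans _ _ (norm1 S^T * (norm1 S^T * d))).
  apply: norm1_mulmx_le => [|k l]; first by rewrite mulr_ge0 ?norm1_ge0.
  by rewrite mxE; apply: norm1_mulmx_le => // k' l'; exact/ltW.
by rewrite mulrA /d mulrCA ler_piMr ?(ltW e20) // ler_pdivrMr // mul1r lerDl.
Qed.

(** Elementary degenerations are straight lines [P + t E] whose points other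
    than [P] all come from [Q]. *)
Lemma degen_line m n (P E : pencil m m) (Q : pencil n n) :
  (forall t : C, t != 0 -> exists S : 'M[C]_(n, m),
     forall b, S^T *m Q b *m S = P b + t *: E b) -> degen P Q.
Proof.
move=> PEQ e e0; pose K := norm1 (E true) + norm1 (E false) + 1.
have K0 : 0 < K by rewrite ltr_wpDl ?addr_ge0 ?norm1_ge0.
have t0 : 0 < e / K by rewrite divr_gt0.
have [S SE] := PEQ _ (lt0r_neq0 t0); exists S => b i j.
rewrite SE opprD addNKr !mxE normrN normrM gtr0_norm // mulrAC ltr_pdivrMr //.
rewrite ltr_pM2l //; apply: le_lt_trans (ler_norm1 _ i j) _.
rewrite /K; case: b; first by rewrite -addrA ltrDl ltr_wpDl ?norm1_ge0.
by rewrite addrAC ltrDr ltr_wpDl ?norm1_ge0.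
Qed.

Lemma degen_dsum m n p q (P : pencil m m) (Q : pencil n n)
    (P' : pencil p p) (Q' : pencil q q) :
  degen P Q -> degen P' Q' -> degen (dsum P P') (dsum Q Q').
Proof.
move=> PQ P'Q' e e0; have [S SP] := PQ _ e0; have [S' SP'] := P'Q' _ e0.
exists (block_mx S 0 0 S') => b i j.
rewrite /dsum tr_block_mx !trmx0 !mulmx_block !(mul0mx, mulmx0, addr0, add0r).
rewrite opp_block_mx add_block_mx !oppr0 !addr0.
have [k ->|k ->] := fintype.split_ordP i; have [l ->|l ->] := fintype.split_ordP j;
  by rewrite ?block_mxEul ?block_mxEur ?block_mxEdl ?block_mxEdr // mxE normr0.
Qed.

Definition sel_mx m n (f : 'I_m -> 'I_n) : 'M[C]_(m, n) := \matrix_(i, j) (f i == j)%:R.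

Lemma sel_mxE m n p q (f : 'I_m -> 'I_n) (g : 'I_q -> 'I_p) (A : 'M[C]_(n, p)) i j :
  (sel_mx f *m A *m (sel_mx g)^T) i j = A (f i) (g j).
Proof.
rewrite mxE (bigD1 (g j)) //= big1 => [|k kg]; last first.
  by rewrite [X in _ * X]mxE [X in _ * X]mxE eq_sym (negPf kg) mulr0.
rewrite addr0 [X in _ * X]mxE [X in _ * X]mxE eqxx mulr1 mxE (bigD1 (f i)) //= big1 => [|k kf].
  by rewrite addr0 mxE eqxx mul1r.
by rewrite mxE eq_sym (negPf kf) mul0r.
Qed.

(** Any map [f] of indices is allowed: the associated 0-1 matrix serves as [S].
    This gives all permutations and regroupings of blocks. *)
Lemma degen_reindex m n (P : pencil m m) (Q : pencil n n) (f : 'I_m -> 'I_n) :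
  (forall b i j, P b i j = Q b (f i) (f j)) -> degen P Q.
Proof.
move=> PE; apply: (@degen_congr _ _ _ _ (sel_mx f)^T) => b.
by apply/matrixP => i j; rewrite trmxK sel_mxE.
Qed.

Lemma degen_refl m (P : pencil m m) : degen P P.
Proof. exact: (@degen_reindex _ _ _ _ id). Qed.

Lemma degen_dsumC m n (P : pencil m m) (Q : pencil n n) :
  degen (dsum P Q) (dsum Q P).
Proof.
pose f i := match fintype.split i with inl i => rshift n i | inr i => lshift m i end.
apply: (@degen_reindex _ _ _ _ f) => b i j; rewrite /f /dsum.
have [k ->|k ->] := fintype.split_ordP i; have [l ->|l ->] := fintype.split_ordP j;
by rewrite ?(splitKl, splitKr) ?(block_mxEul, block_mxEur, block_mxEdl, block_mxEdr) // !mxE.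
Qed.

Lemma degen_dsumA m n p (P : pencil m m) (Q : pencil n n) (T : pencil p p) :
  degen (dsum P (dsum Q T)) (dsum (dsum P Q) T).
Proof.
pose f (i : 'I_(m + (n + p))) := match fintype.split i with
  inl i => lshift p (lshift n i)
| inr i => match fintype.split i with
           | inl i => lshift p (rshift m i) | inr i => rshift (m + n) i end end.
apply: (@degen_reindex _ _ _ _ f) => b i j; rewrite /f /dsum.
have [k ->|k ->] := fintype.split_ordP i; have [l ->|l ->] := fintype.split_ordP j;
 rewrite ?(splitKl, splitKr);
 try have [k' ->|k' ->] := fintype.split_ordP k; try have [l' ->|l' ->] := fintype.split_ordP l;
by rewrite ?(splitKl, splitKr) ?(block_mxEul, block_mxEur, block_mxEdl, block_mxEdr) // !mxE.
Qed.

Lemma degen_dsumAr m n p (P : pencil m m) (Q : pencil n n) (T : pencil p p) :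
  degen (dsum (dsum P Q) T) (dsum P (dsum Q T)).
Proof.
apply: degen_trans (degen_dsumC _ _) _.
apply: degen_trans (degen_dsum (degen_refl _) (degen_dsumC _ _)) _.
apply: degen_trans (degen_dsumA _ _ _) _.
apply: degen_trans (degen_dsumC _ _) _.
exact: degen_dsum (degen_refl _) (degen_dsumC _ _).
Qed.

Lemma degen_skew_equiv m n p q (X : pencil m n) (Y : pencil p q)
    (U : 'M[C]_(m, p)) (V : 'M[C]_(q, n)) :
  (forall b, X b = U *m Y b *m V) -> degen (skew_of X) (skew_of Y).
Proof.
move=> XE; apply: (@degen_congr _ _ _ _ (block_mx U^T 0 0 V)) => b.
rewrite /skew_of tr_block_mx !trmx0 !mulmx_block !(mul0mx, mulmx0, addr0, add0r).
by rewrite XE trmxK !trmx_mul !mulmxN !mulNmx mulmxA.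
Qed.

Lemma degen_skew_reindex m n p q (X : pencil m n) (Y : pencil p q) f g :
  (forall b i j, X b i j = Y b (f i) (g j)) -> degen (skew_of X) (skew_of Y).
Proof.
move=> XE; apply: (@degen_skew_equiv _ _ _ _ _ _ (sel_mx f) (sel_mx g)^T) => b.
by apply/matrixP => i j; rewrite sel_mxE.
Qed.

(** Exchanging the two halves transposes [X] up to sign. *)
Lemma degen_skew_tr m n (X : pencil m n) (Y : pencil n m) :
  (forall b, X b = (Y b)^T) -> degen (skew_of X) (skew_of Y).
Proof.
move=> XE; apply: (@degen_congr _ _ _ _ (block_mx 0 1%:M (- 1%:M) 0)) => b.
rewrite /skew_of XE tr_block_mx !trmx0 !mulmx_block !(mul0mx, mulmx0, addr0, add0r).
rewrite [(- 1%:M)^T]linearN /= !trmx1 trmxK.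
by rewrite !(mulNmx, mulmxN, mul1mx, mulmx1, opprK).
Qed.

Definition shuffle m n p q (i : 'I_((m + n) + (p + q))) :
    'I_((m + p) + (n + q)) :=
  match fintype.split i with
  | inl i => match fintype.split i with
             | inl i => lshift _ (lshift _ i) | inr i => rshift _ (lshift _ i) end
  | inr i => match fintype.split i with
             | inl i => lshift _ (rshift _ i) | inr i => rshift _ (rshift _ i) end
  end.

Lemma degen_dsum_skew m n p q (X : pencil m n) (Y : pencil p q) :
  degen (dsum (skew_of X) (skew_of Y)) (skew_of (dsum X Y)).
Proof.
apply: (@degen_reindex _ _ _ _ (@shuffle m n p q)) => b i j.
rewrite /shuffle /dsum /skew_of tr_block_mx opp_block_mx !trmx0 !oppr0.
have [k ->|k ->] := fintype.split_ordP i; have [l ->|l ->] := fintype.split_ordP j;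
 rewrite ?(splitKl, splitKr);
 have [k' ->|k' ->] := fintype.split_ordP k; have [l' ->|l' ->] := fintype.split_ordP l;
by rewrite ?(splitKl, splitKr) ?(block_mxEul, block_mxEur, block_mxEdl, block_mxEdr) // !mxE.
Qed.

Lemma degen_skew_dsum m n p q (X : pencil m n) (Y : pencil p q) :
  degen (skew_of (dsum X Y)) (dsum (skew_of X) (skew_of Y)).
Proof.
apply: (@degen_reindex _ _ _ _ (@shuffle m p n q)) => b i j.
rewrite /shuffle /dsum /skew_of tr_block_mx opp_block_mx !trmx0 !oppr0.
have [k ->|k ->] := fintype.split_ordP i; have [l ->|l ->] := fintype.split_ordP j;
 rewrite ?(splitKl, splitKr);
 have [k' ->|k' ->] := fintype.split_ordP k; have [l' ->|l' ->] := fintype.split_ordP l;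
by rewrite ?(splitKl, splitKr) ?(block_mxEul, block_mxEur, block_mxEdl, block_mxEdr) // !mxE.
Qed.

Definition lower_glue m n p q (X : pencil m n) (x : pencil p n) (Z : pencil p q)
  : pencil (m + p) (n + q) := fun b => block_mx (X b) 0 (x b) (Z b).

(** Scaling the rows of [Z] by [t] and its columns by [1/t] fixes [X] and [Z]
    and multiplies [x] by [t], which then goes to 0. *)
Lemma degen_lower_glue m n p q (X : pencil m n) (x : pencil p n) (Z : pencil p q) :
  degen (skew_of (dsum X Z)) (skew_of (lower_glue X x Z)).
Proof.
apply: (@degen_line _ _ _ (skew_of (fun b => block_mx 0 0 (x b) 0))) => t t0.
exists (block_mx (block_mx 1%:M 0 0 t%:M) 0 0 (block_mx 1%:M 0 0 (t^-1)%:M)) => b.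
rewrite /skew_of /lower_glue /dsum.
rewrite !tr_block_mx !trmx0 !tr_scalar_mx !mulmx_block !(mul0mx, mulmx0, addr0, add0r).
rewrite !opp_block_mx !mulmx_block !mul1mx !(mul0mx, mulmx0, addr0, add0r, oppr0, mulmx1).
rewrite !(mulNmx, mulmxN, mul1mx, mulmx1, mul0mx, mulmx0, oppr0, add0r, addr0).
rewrite !(mul_scalar_mx, mul_mx_scalar) !scalerA divff // mulVf // !scale1r.
by rewrite !(scale_block_mx, scaler0, scalerN, add_block_mx, add0r, addr0).
Qed.

(** Attach [Z] to both [X] and [Y], by [x] and by [y].  Letting [x] tend to 0
    leaves [Z] attached to [Y] alone.  On the other hand, the intertwiners
    [P] and [Q] give row and column operations that cancel [y] against [x]
    while keeping [X] and [Y] uncoupled, so the pencil is equivalent to the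
    one with [Z] attached to [X] alone. *)
Lemma degen_transplant m n p q k l (X : pencil m n) (Y : pencil p q) (Z : pencil k l)
   (x : pencil k n) (y : pencil k q) (P : 'M[C]_(m, p)) (Q : 'M[C]_(n, q)) :
  (forall b, X b *m Q = P *m Y b) -> (forall b, x b *m Q = y b) ->
  degen (dsum (skew_of X) (skew_of (lower_glue Y y Z)))
        (dsum (skew_of Y) (skew_of (lower_glue X x Z))).
Proof.
move=> XQ xQ.
apply: degen_trans (degen_dsum_skew _ _) _.
apply: degen_trans (degen_lower_glue _ (fun b => col_mx 0 (x b)) _) _.
apply: degen_trans (degen_skew_dsum _ _).
pose T : pencil _ _ := fun b => block_mx (X b) 0 (col_mx 0 (x b)) (block_mx (Y b) 0 0 (Z b)).
apply: (@degen_trans _ _ _ (skew_of T)).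
  apply: (@degen_skew_equiv _ _ _ _ _ _ (block_mx 1%:M (row_mx (- P) 0) 0 1%:M)
    (block_mx 1%:M (row_mx Q 0) 0 1%:M)) => b.
  rewrite /lower_glue /T !mulmx_block !mul1mx !mulmx1 !(mul0mx, mulmx0, addr0, add0r).
  rewrite mul_row_col mulmx0 mul0mx !addr0.
  rewrite mul_row_block !(mul0mx, mulmx0, addr0, add0r) mul_mx_row mulmx0 XQ.
  rewrite add_row_mx mulNmx subrr addr0 row_mx0 mul_col_row !(mul0mx, mulmx0) xQ.
  by rewrite add_block_mx !(addr0, add0r).
pose f m p k (i : 'I_(m + (p + k))) : 'I_(p + (m + k)) := match fintype.split i with
  inl i => rshift _ (lshift _ i)
| inr i => match fintype.split i with
           | inl i => lshift _ i | inr i => rshift _ (rshift _ i) end end.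
apply: (@degen_skew_reindex _ _ _ _ _ _ (@f _ _ _) (@f _ _ _)) => b i j.
rewrite /f /dsum /lower_glue /T.
have [i1 ->|i1 ->] := fintype.split_ordP i; have [j1 ->|j1 ->] := fintype.split_ordP j;
 rewrite ?(splitKl, splitKr);
 try have [i2 ->|i2 ->] := fintype.split_ordP i1; try have [j2 ->|j2 ->] := fintype.split_ordP j1;
by rewrite ?(splitKl, splitKr) ?(block_mxEul, block_mxEur, block_mxEdl, block_mxEdr) //
  ?(col_mxEu, col_mxEd) // !mxE.
Qed.

End Degeneration.

(** * Rank under degeneration *)

Section Rank.
Variable C : numFieldType.
Local Notation pencil m n := (bool -> 'M[C]_(m, n)).

(** If [M] had rank [k > r], fix [U] and [V] with [U M V = 1] of size [k].  For
    [N] close to [M] of rank at most [r], the matrix [U N V] is close to 1 and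
    singular; a kernel vector [v] then has a 1-norm smaller than itself. *)
Lemma rank_approx m n (M : 'M[C]_(m, n)) r :
  (forall e : C, 0 < e -> exists2 N : 'M[C]_(m, n),
     (\rank N <= r)%N & forall i j, `|(M - N) i j| <= e) ->
  (\rank M <= r)%N.
Proof.
move=> Mapprox; rewrite leqNgt; apply/negP => rM; set k : nat := \rank M in rM.
have [V V1] := row_freeP (row_base_free M).
have [U U1] := row_fullP (col_base_full M).
have UMV : U *m (col_base M *m row_base M) *m V = 1%:M by rewrite mulmxA U1 mul1mx.
rewrite mulmx_base in UMV.
pose K := norm1 U * norm1 V^T.
have K0 : 0 <= K by rewrite mulr_ge0 ?norm1_ge0.
have kK0 : 0 < k%:R * K + 1 by apply: ltr_wpDl ltr01; exact: mulr_ge0 (ler0n _ _) K0.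
have e0 : 0 < (k%:R * K + 1)^-1 by rewrite invr_gt0.
have [N rN MN] := Mapprox _ e0; set e := _^-1 in e0 MN.
pose G := U *m N *m V.
have GE i j : `|(1%:M - G) i j| <= K * e.
  have -> : 1%:M - G = (V^T *m (U *m (M - N))^T)^T.
    by rewrite trmx_mul !trmxK mulmxBr mulmxBl UMV.
  rewrite mxE /K [norm1 U * _]mulrC -mulrA; apply: norm1_mulmx_le => [|i' j'].
    by rewrite mulr_ge0 ?norm1_ge0 ?ltW.
  by rewrite mxE; apply: norm1_mulmx_le => //; exact: ltW.
have /rowV0Pn[v /sub_kermxP vG v0] : kermx G != 0.
  rewrite kermx_eq0 -row_leq_rank -ltnNge (leq_ltn_trans _ rM) //.
  apply: leq_trans rN; apply: leq_trans (mxrankM_maxl _ _) _.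
  exact: mxrankM_maxr.
have vE : v = v *m (1%:M - G) by rewrite mulmxBr vG mulmx1 subr0.
have nv0 : 0 < norm1 v.
  rewrite lt_def norm1_ge0 andbT; apply: contra v0 => /eqP nv.
  apply/eqP/matrixP => i j; rewrite mxE; apply/eqP; rewrite -normr_le0 -nv.
  exact: ler_norm1.
have : norm1 v <= norm1 v * (k%:R * K * e).
  rewrite {1}/norm1 big_ord1; apply: le_trans (_ : \sum_(j < k) (norm1 v * (K * e)) <= _).
    by apply: ler_sum => j _; rewrite [in leLHS]vE; apply: norm1_mulmx_le => //;
      rewrite mulr_ge0 // ltW.
  by rewrite sumr_const card_ord -[leLHS]mulr_natl mulrCA -mulrA.
have lt1 : norm1 v * (k%:R * K * e) < norm1 v.
  by rewrite gtr_pMr // /e ltr_pdivrMr // mul1r ltrDl ltr01.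
by move=> /le_lt_trans/(_ lt1); rewrite ltxx.
Qed.

Lemma exists_nonroot (p : {poly C}) (u : nat -> C) :
  p != 0 -> injective u -> exists i, ~~ root p (u i).
Proof.
move=> p0 uI; pose s := [seq u i | i <- iota 0 (size p)].
have [s0|/allPn[x /mapP[i _ ->] ?]] := boolP (all (root p) s); last by exists i.
have := max_poly_roots p0 s0; rewrite map_inj_uniq ?iota_uniq //.
by rewrite size_map size_iota ltnn => /(_ isT).
Qed.

Lemma natr_inj : injective (fun i => i%:R : C).
Proof. by move=> i j /eqP; rewrite eqr_nat => /eqP. Qed.

Definition pencil_at m n (P : pencil m n) (x : C) := x *: P true - P false.

Lemma degen_rank m n (P : pencil m m) (Q : pencil n n) x :
  degen P Q -> (\rank (pencil_at P x) <= \rank (pencil_at Q x))%N.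
Proof.
move=> PQ; apply: rank_approx => e e0.
have x0 : 0 < `|x| + 1 by rewrite ltr_wpDl.
have [S SP] := PQ _ (divr_gt0 e0 x0).
exists (S^T *m pencil_at Q x *m S) => [|i j].
  by apply: leq_trans (mxrankM_maxl _ _) _; exact: mxrankM_maxr.
have -> : pencil_at P x - S^T *m pencil_at Q x *m S =
    x *: (P true - S^T *m Q true *m S) - (P false - S^T *m Q false *m S).
  rewrite /pencil_at mulmxBr mulmxBl -scalemxAr -scalemxAl scalerBr !opprB.
  by rewrite [X in _ + X = _]addrC addrACA [X in _ = _ + X]addrC.
have -> : e = `|x| * (e / (`|x| + 1)) + e / (`|x| + 1).
  by rewrite -[X in _ + X]mul1r -mulrDl mulrC divfK // gt_eqF.
have S1 := SP true i j; have S2 := SP false i j.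
move: (P true - _) (P false - _) S1 S2 => A B S1 S2.
rewrite !mxE (le_trans (ler_normD _ _)) // normrN normrM lerD ?ler_wpM2l //; exact: ltW.
Qed.

Lemma rank_minor m n (A : 'M[C]_(m, n)) :
  exists f : 'I_(\rank A) -> 'I_m, exists g : 'I_(\rank A) -> 'I_n, \det (mxsub f g A) != 0.
Proof.
pose B := (rowsub (maxrankfun A) A)^T.
have fB : row_full B by rewrite /row_full mxrank_tr; exact: maxrowsub_free.
exists (maxrankfun A), (fullrankfun fB).
rewrite -det_tr -unitfE -unitmxE.
suff -> : (mxsub (maxrankfun A) (fullrankfun fB) A)^T = rowsub (fullrankfun fB) B.
  exact: fullrowsub_unit.
by apply/matrixP => i j; rewrite !mxE.
Qed.

Lemma minor_rank m n k (A : 'M[C]_(m, n)) (f : 'I_k -> 'I_m) (g : 'I_k -> 'I_n) :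
  \det (mxsub f g A) != 0 -> (k <= \rank A)%N.
Proof.
rewrite -unitfE -unitmxE => /mxrank_unit <-.
have -> : mxsub f g A = sel_mx C f *m A *m (sel_mx C g)^T.
  by apply/matrixP => i j; rewrite sel_mxE mxE.
by apply: leq_trans (mxrankM_maxl _ _) _; exact: mxrankM_maxr.
Qed.
End Rank.

(** * Orbit closures in the metric of pencils *)

Section Topology.
Variable R : realType.
Local Notation C := R[i].

Definition coefs n (P : skew_pencil R n) (b : bool) : 'M[C]_n := if b then P.1 else P.2.

Lemma pencil_at_minor n (P : skew_pencil R n) k (f g : 'I_k -> 'I_n) x :
  (\det (mxsub f g (pencil_polymx P))).[x] = \det (mxsub f g (pencil_at (coefs P) x)).
Proof.
rewrite -[LHS]/(horner_eval x _) -det_map_mx; congr (\det _).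
by apply/matrixP => i j; rewrite !mxE /= /horner_eval !hornerE.
Qed.

Lemma rank_at_le n (P : skew_pencil R n) x : (\rank (pencil_at (coefs P) x) <= pencil_rank P)%N.
Proof.
have [f [g fg]] := rank_minor (pencil_at (coefs P) x).
set k := \rank _ in f g fg *.
have kn : (k < n.+1)%N by rewrite ltnS rank_leq_row.
suff Pk : has_nonzero_minor P (Ordinal kn).
  exact: (@leq_bigmax_cond _ (fun k : 'I_n.+1 => has_nonzero_minor P k) (fun k => k : nat) _ Pk).
apply/existsP; exists (finfun f); apply/existsP; exists (finfun g).
apply: contra fg => /eqP/(congr1 (horner^~ x)); rewrite pencil_at_minor horner0 => /eqP.
by congr (\det _ == 0); apply/matrixP => i j; rewrite !mxE !ffunE.
Qed.

Lemma pencil_rank_le n (P : skew_pencil R n) r :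
  (forall x, (\rank (pencil_at (coefs P) x) <= r)%N) -> (pencil_rank P <= r)%N.
Proof.
move=> Pr; apply/bigmax_leqP => -[k kn] /= /existsP[f /existsP[g fg]].
have [i fgi] := exists_nonroot fg (@natr_inj C).
by apply: leq_trans (Pr i%:R); apply: (@minor_rank _ _ _ _ _ f g); rewrite -pencil_at_minor.
Qed.

(** [- S] has finitely many eigenvalues, so some [d / (i + 1)] is not one of them. *)
Lemma unitmx_shift n (S : 'M[C]_n) (d : C) : 0 < d ->
  exists t, [/\ 0 < t, t <= d & S + t%:M \in unitmx].
Proof.
move=> d0; pose p := char_poly (- S).
have p0 : p != 0 by rewrite monic_neq0 ?char_poly_monic.
have uI : injective (fun i => d / (i.+1)%:R).
  by move=> i j /(mulfI (lt0r_neq0 d0)) /invr_inj /natr_inj [].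
have [i px] := exists_nonroot p0 uI.
exists (d / (i.+1)%:R); split.
- by rewrite divr_gt0.
- by rewrite ler_pdivrMr // ler_peMr ?(ltW d0) // ler1n.
rewrite unitmxE unitfE; apply: contra px => /eqP det0; rewrite rootE.
rewrite -[p.[_]]/(horner_eval _ p) -det_map_mx -det0; apply/eqP; congr (\det _).
by apply/matrixP => a b; rewrite !mxE /= /horner_eval !hornerE opprK addrC hornerMn hornerX.
Qed.

Lemma normr_normc (z : C) : `|z| = (normc z)%:C.
Proof. by []. Qed.

Lemma normc_ge0 (z : C) : 0 <= normc z.
Proof. by case: z => a c; exact: sqrtr_ge0. Qed.

Lemma entry_le_dist n (P Q : skew_pencil R n) b i j :
  normc ((coefs P b - coefs Q b) i j) <= pencil_dist P Q.
Proof.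
rewrite -[normc _]ger0_norm ?normc_ge0 // -sqrtr_sqr /pencil_dist ler_wsqrtr //.
have le (A : 'M[C]_n) : normc (A i j) ^+ 2 <= frobenius A ^+ 2.
  rewrite /frobenius sqr_sqrtr; last by do 2!apply: sumr_ge0 => ? _; exact: sqr_ge0.
  rewrite (bigD1 i) //= (bigD1 j) //= -addrA lerDl addr_ge0 //.
    by apply: sumr_ge0 => ? _; exact: sqr_ge0.
  by do 2!apply: sumr_ge0 => ? _; exact: sqr_ge0.
case: b; apply: (le_trans (le _)); rewrite /coefs ?lerDl ?lerDr; exact: sqr_ge0.
Qed.

Lemma pencil_dist_le n (P Q : skew_pencil R n) (e : R) : 0 < e ->
  (forall b i j, normc ((coefs P b - coefs Q b) i j) <= e) ->
  pencil_dist P Q <= Num.sqrt (2 * (n * n)%:R) * e.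
Proof.
move=> e0 PQ; rewrite -[e]gtr0_norm // -sqrtr_sqr -sqrtrM // ler_wsqrtr //.
have le b : frobenius (coefs P b - coefs Q b) ^+ 2 <= (n * n)%:R * e ^+ 2.
  rewrite /frobenius sqr_sqrtr; last by do 2!apply: sumr_ge0 => ? _; exact: sqr_ge0.
  rewrite natrM -mulrA mulr_natl -[X in _ *+ X]card_ord -sumr_const ler_sum // => i _.
  rewrite mulr_natl -[X in _ *+ X]card_ord -sumr_const ler_sum // => j _.
  by rewrite ler_pXn2r ?nnegrE ?normc_ge0 ?(ltW e0).
by rewrite -mulrA mulr_natl mulr2n lerD //; [exact: (le true)|exact: (le false)].
Qed.

(** From right to left, the limit is first approached by [S^T Q S] with [S]
    arbitrary; adding a small scalar matrix to [S] makes it invertible and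
    moves the result by at most a constant multiple of that scalar. *)
Lemma closure_orbitP n (P Q : skew_pencil R n) :
  closure (congr_orbit Q) P <-> degen (coefs P) (coefs Q).
Proof.
split=> [PQ e e0|PQ B].
  have [er eE] : exists er : R, e = er%:C.
    by exists (complex.Re e); rewrite RRe_real ?gtr0_real.
  have er0 : 0 < er by rewrite eE ltcR in e0.
  have [T [[S Su ->] PT]] := PQ _ (nbhsx_ballx P er er0).
  exists S => b i j; rewrite normr_normc eE ltcR; apply: le_lt_trans PT.
  have -> : S^T *m coefs Q b *m S = coefs (congr_pencil S Q) b by case: b.
  exact: entry_le_dist.
move=> /nbhs_ballP[er /= er0 BP].
pose K : R := Num.sqrt (2 * (n * n)%:R) + 1.
have K0 : 0 < K by apply: ltr_wpDl ltr01; exact: sqrtr_ge0.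
pose d : R := er / K / 2; have d0 : 0 < d by rewrite !divr_gt0.
have dh0 : 0 < d%:C / 2 :> C by rewrite divr_gt0 // ltcR.
have [S SP] := PQ _ dh0.
pose L b := norm1 (coefs Q b *m S + S^T *m coefs Q b) + norm1 (coefs Q b).
pose M := L true + L false + 1.
have L0 b : 0 <= L b by rewrite addr_ge0 ?norm1_ge0.
have M0 : 0 < M by apply: ltr_wpDl ltr01; exact: addr_ge0 (L0 _) (L0 _).
have LM b : L b <= M.
  rewrite /M; move: (L0 true) (L0 false).
  by case: b; move: (L true) (L false) => x y x0 y0;
    [rewrite -addrA lerDl addr_ge0|rewrite addrAC lerDr addr_ge0].
(* This bound ensures both [t <= 1] and [t * M <= d / 2]. *)
pose s := (d%:C / 2) / (M + d%:C / 2).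
have Md0 : 0 < M + d%:C / 2 := addr_gt0 M0 dh0.
have s0 : 0 < s := divr_gt0 dh0 Md0.
have [t [t0 ts tu]] := unitmx_shift S s0.
have t1 : t <= 1.
  apply: le_trans ts _; rewrite /s (ler_pdivrMr _ _ Md0) mul1r lerDr; exact: ltW.
have tM : t * M <= d%:C / 2.
  apply: (@le_trans _ _ (s * M)); first by rewrite ler_wpM2r ?(ltW M0).
  rewrite /s mulrAC (ler_pdivrMr _ _ Md0) ler_wpM2l ?(ltW dh0) // lerDl; exact: ltW.
exists (congr_pencil (S + t%:M) Q); split; first by exists (S + t%:M).
apply: BP; rewrite /ball /=.
apply: (@le_lt_trans _ _ (K * d)); last first.
  have -> : K * d = er / 2 by rewrite /d mulrA [K * _]mulrC divfK // gt_eqF.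
  by rewrite ltr_pdivrMr // ltr_pMr // ltr1n.
apply: le_trans (_ : Num.sqrt (2 * (n * n)%:R) * d <= _); last first.
  by rewrite ler_wpM2r ?(ltW d0) // lerDl ler01.
apply: pencil_dist_le => // b i j.
rewrite -lecR -normr_normc.
have -> : coefs (congr_pencil (S + t%:M) Q) b = (S + t%:M)^T *m coefs Q b *m (S + t%:M) by case: b.
have -> : (S + t%:M)^T *m coefs Q b *m (S + t%:M) = S^T *m coefs Q b *m S +
    (t *: (coefs Q b *m S + S^T *m coefs Q b) + (t * t) *: coefs Q b).
  rewrite [(S + _)^T]linearD /= tr_scalar_mx !mulmxDl !mulmxDr !mul_scalar_mx !mul_mx_scalar.
  by rewrite -!scalemxAl scalerA scalerDr !addrA; congr (_ + _); rewrite addrAC.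
have SPb := SP b i j; rewrite opprD addrA mxE (le_trans (ler_normD _ _)) //.
rewrite [leRHS]splitr lerD ?(ltW SPb) // mxE normrN mxE.
apply: le_trans tM; apply: le_trans (ler_normD _ _) _.
apply: le_trans (_ : t * L b <= _); last by rewrite ler_wpM2l ?(ltW t0).
rewrite mulrDr lerD //.
  by rewrite mxE normrM gtr0_norm // ler_wpM2l ?(ltW t0) // ler_norm1.
rewrite mxE !normrM gtr0_norm // -mulrA ler_wpM2l ?(ltW t0) //.
by rewrite -[leRHS]mul1r ler_pM ?(ltW t0) ?ler_norm1.
Qed.

End Topology.

(** * The canonical blocks as bipartite pencils *)

Section Blocks.
Context {R : realType}.
Local Notation C := R[i].

(** For [mu = 0] this is the off-diagonal block of an M-block.  The shift by
    [mu] gives it the label [lambda - mu] of an H-block on its diagonal. *)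
Definition Lpen (mu : C) k (b : bool) : 'M[C]_(k, k.+1) :=
  if b then G_mx k else F_mx k + mu *: G_mx k.
Definition Jpen (mu : C) h (b : bool) : 'M[C]_h :=
  if b then 1%:M else jordan_block h mu.
Definition Npen k (b : bool) : 'M[C]_k :=
  if b then jordan_block k 0 else 1%:M.

Lemma coefs_M k : coefs (M_pencil k) = skew_of (Lpen 0 k).
Proof. by apply/funext => -[]; rewrite /skew_of /Lpen ?scale0r ?addr0. Qed.

Lemma coefs_H h mu : coefs (H_pencil h mu) = skew_of (Jpen mu h).
Proof. by apply/funext => -[]. Qed.

Lemma coefs_K k : coefs (K_pencil k) = skew_of (Npen k).
Proof. by apply/funext => -[]. Qed.

Lemma coefs_dsum m n (P : skew_pencil R m) (Q : skew_pencil R n) :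
  coefs (dsum_pencil P Q) = dsum (coefs P) (coefs Q).
Proof. by apply/funext => -[]. Qed.

(** The matrix of [p(X) |-> p(X + c)] on polynomials of degree less than [k]. *)
Definition taylor (c : C) k : 'M[C]_k := \matrix_(i, j) (('X + c%:P) ^+ j)`_i.

Lemma size_exp_XaddC (c : C) j : size (('X + c%:P) ^+ j) = j.+1.
Proof. by rewrite -[c]opprK polyCN size_exp_XsubC. Qed.

Lemma taylor_unit c k : taylor c k \in unitmx.
Proof.
rewrite -unitmx_tr unitmxE det_trig.
  rewrite unitfE; apply/prodf_neq0 => i _; rewrite !mxE.
  have /monicP := monic_exp i (monicXaddC c).
  by rewrite lead_coefE size_exp_XaddC /= => ->; rewrite oner_eq0.
apply/is_trig_mxP => i j ij; rewrite !mxE nth_default //.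
by rewrite size_exp_XaddC.
Qed.

(** The transpose of [G_k] is the inclusion of polynomials of degree less than
    [k] into those of degree at most [k], which commutes with translation. *)
Lemma taylor_G c k : (@G_mx R k)^T *m taylor c k = taylor c k.+1 *m (@G_mx R k)^T.
Proof.
apply/matrixP => i j; rewrite !mxE.
rewrite (bigD1 (widen_ord (leqnSn k) j)) //= [X in _ = _ + X]big1 => [|l lj]; last first.
  by rewrite !mxE (_ : _ == _ = false) ?mulr0 //; apply/negbTE.
rewrite !mxE eqxx mulr1 addr0.
have [ik|ki] := ltnP i k.
  rewrite (bigD1 (Ordinal ik)) //= big1 => [|l li].
    by rewrite !mxE eqxx mul1r addr0.
  by rewrite !mxE eq_sym (_ : _ == _ = false) ?mul0r //; apply/negbTE.
rewrite big1 => [|l _].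
  by rewrite nth_default // size_exp_XaddC; apply: leq_trans ki; exact: (ltn_ord j).
by rewrite !mxE (_ : _ == _ = false) ?mul0r //; have := ltn_ord l; lia.
Qed.

(** The transpose of [F_k] is multiplication by [X], which translation turns
    into multiplication by [X + c]. *)
Lemma taylor_F c k :
  ((@F_mx R k)^T + c *: (@G_mx R k)^T) *m taylor c k = taylor c k.+1 *m (@F_mx R k)^T.
Proof.
rewrite mulmxDl -scalemxAl taylor_G.
apply/matrixP => i j; rewrite !mxE.
rewrite [in RHS](bigD1 (lift ord0 j)) //= [X in _ = _ + X]big1 => [|l lj]; last first.
  by rewrite !mxE (_ : _ == _ = false) ?mulr0 //; apply/negbTE.
rewrite [X in _ + _ * X](bigD1 (widen_ord (leqnSn k) j)) //=.
rewrite [X in _ + _ * (_ + X)]big1 => [|l lj]; last first.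
  by rewrite !mxE (_ : _ == _ = false) ?mulr0 //; apply/negbTE.
rewrite !mxE !eqxx !mulr1 !addr0 exprS mulrDl coefD coefXM coefCM.
congr (_ + _); case: i => -[|i] ik /=.
  by rewrite big1 // => l _; rewrite !mxE mul0r.
rewrite (bigD1 (Ordinal (ik : (i < k)%N))) //= big1 => [|l li].
  by rewrite !mxE eqxx mul1r addr0.
by rewrite !mxE (_ : _ == _ = false) ?mul0r //; rewrite eqSS eq_sym; apply/negbTE.
Qed.

(** M-blocks have no eigenvalue: translating polynomials by [nu - mu] is an
    equivalence between the two shifted pencils. *)
Lemma degen_Lpen mu nu k : degen (skew_of (Lpen mu k)) (skew_of (Lpen nu k)).
Proof.
pose c := nu - mu.
apply: (@degen_skew_equiv _ _ _ _ _ _ _ (taylor c k)^T (invmx (taylor c k.+1))^T) => b.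
apply: trmx_inj; rewrite !trmx_mul !trmxK.
apply: (canRL (mulKmx (taylor_unit c k.+1))).
have F' : (@F_mx R k)^T *m taylor c k =
    taylor c k.+1 *m (@F_mx R k)^T - c *: (taylor c k.+1 *m (@G_mx R k)^T).
  by rewrite -taylor_F mulmxDl -scalemxAl taylor_G addrK.
case: b; rewrite /Lpen ?taylor_G // ![(_ + _)^T]linearD /= ![(_ *: _)^T]linearZ /=.
rewrite mulmxDr mulmxDl F' -scalemxAl taylor_G.
by rewrite -addrA -scaleNr -scalerDl -scalemxAr; congr (_ + _ *: _); rewrite /c opprB addrNK.
Qed.

End Blocks.

(** * Elementary degenerations of blocks *)

Section BlockDegenerations.
Context {R : realType}.
Local Notation C := R[i].

(** Compares two 0-1 entries by deciding every equation between indices. *)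
Ltac entries := intros; rewrite ?mxE -?val_eqE /=;
  repeat (let e := fresh "e" in case: eqP => e); 
  try by [exfalso; lia | rewrite ?(mulr0, mulr1, addr0, add0r)].

(** [L_(k+h)], shifted by [mu], is bidiagonal with entries [lambda - mu] and [-1].
    Cutting the entry [-1] in row [h - 1] leaves the Jordan block of size [h]
    and the shifted [L_k]. *)
Lemma degen_MH k h (mu : C) :
  degen (dsum (skew_of (Lpen 0 k)) (skew_of (Jpen mu h))) (skew_of (Lpen 0 (k + h))).
Proof.
apply: degen_trans (degen_dsum (degen_Lpen 0 mu k) (degen_refl _)) _.
apply: degen_trans (degen_dsum_skew _ _) _.
pose x b : 'M[C]_(h, k.+1) :=
  if b then 0 else \matrix_(i, j) ((i.+1 == h) && (j == 0 :> nat))%:R.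
apply: degen_trans (degen_lower_glue _ x _) _.
apply: degen_trans (degen_Lpen mu 0 (k + h)).
pose f (i : 'I_(k + h)) : 'I_(k + h) := match fintype.split i with
  inl i => cast_ord (addnC h k) (rshift h i) | inr i => cast_ord (addnC h k) (lshift k i) end.
have e : (h + k.+1 = (k + h).+1)%N by lia.
pose g (i : 'I_(k.+1 + h)) : 'I_(k + h).+1 := match fintype.split i with
  inl i => cast_ord e (rshift h i) | inr i => cast_ord e (lshift k.+1 i) end.
apply: (@degen_skew_reindex _ _ _ _ _ _ _ f g) => b i j; rewrite /f /g /lower_glue.
have [i1 ->|i1 ->] := fintype.split_ordP i; have [j1 ->|j1 ->] := fintype.split_ordP j;
  rewrite ?(splitKl, splitKr) ?(block_mxEul, block_mxEur, block_mxEdl, block_mxEdr);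
  move: (ltn_ord i1) (ltn_ord j1); case: b; rewrite /Lpen /Jpen /x; entries.
Qed.

(** The last row and column of [K_(j+1)] form a [K_1] attached to the remaining
    [K_j] by one entry [lambda].  The [K_1] embeds in the end of [L_k], so that
    entry can be moved to the last column of [L_k], where [K_j], read backwards,
    continues [L_k] to [L_(k+j)]. *)
Lemma degen_MK k j :
  degen (dsum (skew_of (@Lpen R 0 k)) (skew_of (Npen j.+1)))
        (dsum (skew_of (Npen 1)) (skew_of (Lpen 0 (k + j)))).
Proof.
pose x b : 'M[C]_(j, k.+1) :=
  if b then \matrix_(i, c) ((i.+1 == j) && (c == k :> nat))%:R else 0.
pose y b : 'M[C]_(j, 1) :=
  if b then \matrix_(i, c) (i.+1 == j)%:R else 0.
apply: (@degen_trans _ _ _ _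
    (dsum (skew_of (Lpen 0 k)) (skew_of (lower_glue (Npen 1) y (Npen j))))).
  apply: degen_dsum (degen_refl _) _.
  (* Rows and columns of index [j] are the ones that form the [K_1]. *)
  pose f (i : 'I_j.+1) : 'I_(1 + j) :=
    if unlift ord_max i is Some i then rshift 1 i else lshift j ord0.
  apply: (@degen_skew_reindex _ _ _ _ _ _ _ f f) => b i c; rewrite /f /lower_glue.
  case: unliftP => [i1 ->|->]; case: unliftP => [j1 ->|->];
    rewrite ?(block_mxEul, block_mxEur, block_mxEdl, block_mxEdr);
    try move: (ltn_ord i1); try move: (ltn_ord j1);
    case: b; rewrite /Npen /y ?mxE -?val_eqE /= /bump; entries.
apply: degen_trans (@degen_transplant C _ _ _ _ _ _ _ _ (Npen j) x y (\col_i (i.+1 == k)%:R)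
    (delta_mx ord_max 0) _ _) _.
- move=> b; rewrite -colE; apply/matrixP => i o; rewrite mxE [in RHS]mxE big_ord1 (ord1 o).
  by have := ltn_ord i; case: b; rewrite /Lpen /Npen; entries.
- move=> b; rewrite -colE; apply/matrixP => i o; rewrite mxE /x /y.
  by case: b; entries; rewrite ?andbT ?andbF //.
apply: degen_dsum (degen_refl _) _.
pose f (i : 'I_(k + j)) : 'I_(k + j) := match fintype.split i with
  inl i => lshift j i | inr i => rshift k (rev_ord i) end.
pose g (i : 'I_(k.+1 + j)) : 'I_(k + j).+1 := match fintype.split i with
  inl i => lshift j i | inr i => rshift k.+1 (rev_ord i) end.
apply: (@degen_skew_reindex _ _ _ _ _ _ _ f g) => b i c; rewrite /f /g /lower_glue.
have [i1 ->|i1 ->] := fintype.split_ordP i; have [j1 ->|j1 ->] := fintype.split_ordP c;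
  rewrite ?(splitKl, splitKr) ?(block_mxEul, block_mxEur, block_mxEdl, block_mxEdr);
  move: (ltn_ord i1) (ltn_ord j1); case: b; rewrite /Lpen /Npen /x; entries.
Qed.

(** Cutting one diagonal entry [lambda] of the nilpotent Jordan block of size
    [a + b + 1] leaves [L_a] and the transpose of [L_b], read backwards. *)
Lemma degen_MM_H a b :
  degen (dsum (skew_of (@Lpen R 0 a)) (skew_of (Lpen 0 b))) (skew_of (Jpen 0 (a + b).+1)).
Proof.
pose L' l : 'M[C]_(b.+1, b) :=
  if l then \matrix_(i, j) (i == j.+1 :> nat)%:R else \matrix_(i, j) (i == j :> nat)%:R.
apply: (@degen_trans _ _ _ _ (dsum (skew_of (Lpen 0 a)) (skew_of L'))).
  apply: degen_dsum (degen_refl _) _.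
  apply: (@degen_trans _ _ _ _ (skew_of (fun l => (Lpen 0 b l)^T))).
    by apply: degen_skew_tr => l; rewrite trmxK.
  apply: (@degen_skew_reindex _ _ _ _ _ _ _ (@rev_ord _) (@rev_ord _)) => l i j.
  by move: (ltn_ord i) (ltn_ord j); case: l; rewrite /Lpen /L'; entries.
apply: degen_trans (degen_dsum_skew _ _) _.
pose x l : 'M[C]_(b.+1, a.+1) :=
  if l then \matrix_(i, j) ((i == 0 :> nat) && (j == a :> nat))%:R else 0.
apply: degen_trans (degen_lower_glue _ x _) _.
apply: (@degen_skew_reindex _ _ _ _ _ _ _ (cast_ord (addnS a b)) id) => l i j.
rewrite /lower_glue.
have [i1 ->|i1 ->] := fintype.split_ordP i; have [j1 ->|j1 ->] := fintype.split_ordP j;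
  rewrite ?(block_mxEul, block_mxEur, block_mxEdl, block_mxEdr);
  move: (ltn_ord i1) (ltn_ord j1); case: l; rewrite /Lpen /Jpen /x /L'; entries.
Qed.

Lemma sel_mx_comp m n p (f : 'I_m -> 'I_n) (g : 'I_n -> 'I_p) :
  sel_mx C f *m sel_mx C g = sel_mx C (g \o f).
Proof.
apply/matrixP => i j; rewrite !mxE (bigD1 (f i)) //= big1 => [|l li].
  by rewrite !mxE eqxx mul1r addr0.
by rewrite !mxE eq_sym (negPf li) mul0r.
Qed.

Lemma Lpen_sel_mx k b :
  Lpen (0 : C) k b = sel_mx C (if b then widen_ord (leqnSn k) else lift ord0).
Proof.
by apply/matrixP => i j; case: b; rewrite /Lpen ?scale0r ?addr0 !mxE -val_eqE eq_sym.
Qed.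

(** The last row and column of [L_(c+1)] attach an entry [-1] to [L_c] through
    an entry [lambda].  As [a <= c], the last columns of [L_a] and [L_c] can be
    aligned: the shift by [c - a] intertwines both, and the extra row can be
    transplanted to [L_a]. *)
Lemma degen_MM a c : (a <= c)%N ->
  degen (dsum (skew_of (@Lpen R 0 a)) (skew_of (Lpen 0 c.+1)))
        (dsum (skew_of (Lpen 0 c)) (skew_of (Lpen 0 a.+1))).
Proof.
move=> ac.
pose x k b : 'M[C]_(1, k.+1) := if b then sel_mx C (fun=> ord_max) else 0.
pose Z b : 'M[C]_1 := if b then 0 else 1%:M.
apply: (@degen_trans _ _ _ _ (dsum (skew_of (Lpen 0 a)) (skew_of (lower_glue (Lpen 0 c) (x c) Z)))).
  apply: degen_dsum (degen_refl _) _.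
  pose f k (i : 'I_k.+1) : 'I_(k + 1) :=
    if unlift ord_max i is Some i then lshift 1 i else rshift k ord0.
  apply: (@degen_skew_reindex _ _ _ _ _ _ _ (@f _) (@f _)) => b i j; rewrite /f /lower_glue.
  case: unliftP => [i1 ->|->]; case: unliftP => [j1 ->|->];
    rewrite ?(block_mxEul, block_mxEur, block_mxEdl, block_mxEdr);
    try move: (ltn_ord i1); try move: (ltn_ord j1);
    case: b; rewrite /Lpen /x /Z ?mxE -?val_eqE /= /bump; entries.
have fP k l (i : 'I_k) : (k <= l -> i + (l - k) < l)%N by have := ltn_ord i; lia.
pose f i := Ordinal (fP _ _ i ac); pose g i := Ordinal (fP _ _ i (ac : a < c.+1)%N).
apply: degen_trans (@degen_transplant C _ _ _ _ _ _ _ _ Z (x a) (x c)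
    (sel_mx C f) (sel_mx C g) _ _) _.
- move=> b; rewrite !Lpen_sel_mx !sel_mx_comp; congr sel_mx; apply/funext => i; apply: val_inj.
  by case: b => /=; rewrite /bump /=; lia.
- move=> b; rewrite /x; case: b; last by rewrite mul0mx.
  by rewrite sel_mx_comp; congr sel_mx; apply/funext => i; apply: val_inj => /=; lia.
apply: degen_dsum (degen_refl _) _.
apply: (@degen_skew_reindex _ _ _ _ _ _ _ (cast_ord (addn1 a)) (cast_ord (addn1 a.+1))) => b i j.
rewrite /lower_glue.
have [i1 ->|i1 ->] := fintype.split_ordP i; have [j1 ->|j1 ->] := fintype.split_ordP j;
  rewrite ?(block_mxEul, block_mxEur, block_mxEdl, block_mxEdr);
  move: (ltn_ord i1) (ltn_ord j1); case: b; rewrite /Lpen /Z /x; entries.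
Qed.

End BlockDegenerations.

(** * Degenerations of lists of blocks *)

Section BlockLists.
Context {R : realType}.
Local Notation C := R[i].
Local Notation skblock := (@skblock R).

(* Classical equality, for the use of [perm_eq] on lists of blocks. *)
HB.instance Definition _ := gen_eqMixin skblock.

Local Notation D bs := (coefs (diag_pencil bs)).
Local Notation B b := (coefs (skblock_pencil b)).

(** [degen] relates pencils of unrelated sizes, so equality of the sizes is part
    of the definition. *)
Definition degen_blocks (bs cs : seq skblock) :=
  diag_dim bs = diag_dim cs /\ degen (D bs) (D cs).

Lemma degen_blocks_refl bs : degen_blocks bs bs.
Proof. by split=> //; exact: degen_refl. Qed.

Lemma degen_blocks_trans cs bs ds :
  degen_blocks bs cs -> degen_blocks cs ds -> degen_blocks bs ds.
Proof. by move=> [e bc] [e' cd]; split; [exact: etrans e e'|exact: degen_trans bc cd]. Qed.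

Lemma degen_blocks_cons b bs cs :
  degen_blocks bs cs -> degen_blocks (b :: bs) (b :: cs).
Proof.
move=> [e bc]; split; first by rewrite /= e.
by rewrite /= !coefs_dsum; exact: degen_dsum (degen_refl _) bc.
Qed.

Lemma degen_blocks_pair b1 b2 c1 c2 bs :
  (skblock_dim b1 + skblock_dim b2 = skblock_dim c1 + skblock_dim c2)%N ->
  degen (dsum (B b1) (B b2)) (dsum (B c1) (B c2)) ->
  degen_blocks [:: b1, b2 & bs] [:: c1, c2 & bs].
Proof.
move=> e bc; split; first by rewrite /= !addnA e.
rewrite /= !coefs_dsum.
apply: degen_trans (degen_dsumA _ _ _) _; apply: degen_trans _ (degen_dsumAr _ _ _).
exact: degen_dsum bc (degen_refl _).
Qed.

Lemma degen_blocks_merge b1 b2 c bs :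
  (skblock_dim b1 + skblock_dim b2 = skblock_dim c)%N ->
  degen (dsum (B b1) (B b2)) (B c) ->
  degen_blocks [:: b1, b2 & bs] (c :: bs).
Proof.
move=> e bc; split; first by rewrite /= !addnA e.
rewrite /= !coefs_dsum; apply: degen_trans (degen_dsumA _ _ _) _.
exact: degen_dsum bc (degen_refl _).
Qed.

Lemma degen_blocks_rot b s t : degen_blocks (b :: s ++ t) (s ++ b :: t).
Proof.
elim: s => [|c s IH]; first exact: degen_blocks_refl.
apply: degen_blocks_trans (degen_blocks_cons c IH).
by apply: degen_blocks_pair; [exact: addnC|exact: degen_dsumC].
Qed.

Lemma degen_blocks_perm bs cs : perm_eq bs cs -> degen_blocks bs cs.
Proof.
move=> bc; apply: (catCA_perm_ind (P := degen_blocks bs)) bc (degen_blocks_refl bs).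
move=> s1 s2 s3 bs123; apply: degen_blocks_trans bs123 _.
elim: s1 => [|b s1 IH]; first exact: degen_blocks_refl.
apply: degen_blocks_trans (degen_blocks_cons b IH) _.
exact: degen_blocks_rot.
Qed.

Definition is_Mblk (b : skblock) := if b is Mblk _ then true else false.

Definition MK_blocks (ms : seq nat) r : seq skblock := map (@Mblk R) ms ++ nseq r (Kblk 1).

(** One M-block eats the rest of the list from left to right, passing over the
    other M-blocks. *)
Lemma degen_absorb bs k : all skblock_valid bs ->
  exists2 ms, size ms = (count is_Mblk bs).+1 &
    degen_blocks (Mblk k :: bs) (MK_blocks ms (count is_Kblk bs)).
Proof.
elim: bs k => [|[h mu|j|m] bs IH] k /=.
- by exists [:: k] => //; exact: degen_blocks_refl.
- move=> /andP[_ vbs]; have [ms sz deg] := IH (k + h)%N vbs; exists ms => //.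
  apply: degen_blocks_trans deg; apply: degen_blocks_merge => /=; first lia.
  by rewrite !coefs_M coefs_H; exact: degen_MH.
- case: j => // j vbs; have [ms sz deg] := IH (k + j)%N vbs; exists ms => //.
  apply: (@degen_blocks_trans [:: Kblk 1, Mblk (k + j) & bs]).
    apply: degen_blocks_pair => /=; first lia.
    by rewrite !coefs_M !coefs_K; exact: degen_MK.
  apply: degen_blocks_trans (degen_blocks_cons _ deg) _; exact: degen_blocks_rot.
- move=> vbs; have [ms sz deg] := IH k vbs; exists (m :: ms); first by rewrite /= sz.
  apply: degen_blocks_trans (degen_blocks_cons (Mblk m) deg).
  by apply: degen_blocks_pair; [exact: addnC|exact: degen_dsumC].
Qed.

(** Each round replaces three M-blocks by one, so it lowers their number by 2. *)
Lemma degen_merge3 d t ms r : size ms = (d.+1 + 2 * t)%N ->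
  exists2 ms', size ms' = d.+1 & degen_blocks (MK_blocks ms r) (MK_blocks ms' r).
Proof.
elim: t ms => [|t IH] ms.
  by rewrite muln0 addn0 => sz; exists ms => //; exact: degen_blocks_refl.
case: ms => [|c [|a [|b ms]]] /= sz; try lia.
have [|ms' sz' deg] := IH ((c + (a + b).+1)%N :: ms); first by rewrite /=; lia.
exists ms' => //; apply: degen_blocks_trans deg.
apply: (@degen_blocks_trans [:: Mblk c, Hblk (a + b).+1 0 & MK_blocks ms r]).
  apply: degen_blocks_cons; apply: degen_blocks_merge => /=; first lia.
  by rewrite !coefs_M coefs_H; exact: degen_MM_H.
apply: degen_blocks_merge => /=; first lia.
by rewrite !coefs_M coefs_H; exact: degen_MH.
Qed.

Lemma perm_MK_blocks ms ms' r : perm_eq ms ms' -> perm_eq (MK_blocks ms r) (MK_blocks ms' r).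
Proof. by move=> e; rewrite /MK_blocks perm_cat2r perm_map. Qed.

(** While two sizes differ by at least 2, bringing them closer decreases the sum
    of squares.  When none do, all sizes are [a] or [a + 1], where the minimum
    [a] occurs, and Euclidean division determines the multiplicities. *)
Lemma degen_balance ms r : (0 < size ms)%N ->
  let d := size ms in let s := (sumn ms %% d)%N in let a := (sumn ms %/ d)%N in
  degen_blocks (MK_blocks ms r) (MK_blocks (nseq s a.+1 ++ nseq (d - s) a) r).
Proof.
have [N] := ubnP (sumn [seq k * k | k <- ms]%N); elim: N ms => // N IH ms leN sz.
have [/hasP[a am /hasP[b bm ab]]|] := boolP (has (fun a => has (fun b => a.+1 < b)%N ms) ms).
  have /perm_trans-/(_ _ _)/= := perm_to_rem am.
  have bm' : b \in rem a ms by apply: rem_mem bm; lia.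
  move=> /(_ [:: a, b & rem b (rem a ms)]); rewrite perm_cons perm_to_rem // => /(_ isT).
  move: (rem b _) => t pm; case: b ab => // c ac in bm bm' pm *.
  have pmap := perm_map (fun k => k * k)%N pm.
  move: leN; rewrite (perm_sumn pmap) /= => leN.
  rewrite (perm_sumn pm) (perm_size pm) /=.
  apply: degen_blocks_trans (degen_blocks_perm (perm_MK_blocks r pm)) _.
  have := IH [:: c, a.+1 & t] _ isT; rewrite /= => {}IH.
  have -> : (a + (c.+1 + sumn t) = c + (a.+1 + sumn t))%N by lia.
  apply: degen_blocks_trans (IH _); last by nia.
  apply: degen_blocks_pair => /=; first lia.
  by rewrite !coefs_M; apply: degen_MM; lia.
rewrite -all_predC => /allP noab /=.
have exm : exists a, a \in ms by case: ms sz {leN noab} => // a ms _; exists a; rewrite mem_head.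
case: (ex_minnP exm) => a am amin.
have two x : x \in ms -> (x == a.+1) || (x == a).
  move=> xm; have := amin _ xm; have /hasPn/(_ x xm) := noab _ am; lia.
apply: degen_blocks_perm; apply: perm_MK_blocks.
set c := count_mem a.+1 ms.
have pm : perm_eq ms (nseq c a.+1 ++ nseq (size ms - c) a).
  rewrite -(perm_filterC (pred1 a.+1) ms).
  have /all_pred1P -> := filter_all (pred1 a.+1) ms.
  have -> : seq.filter (predC (pred1 a.+1)) ms = nseq (size ms - c) a.
    have : all (pred1 a) (seq.filter (predC (pred1 a.+1)) ms).
      by apply/allP => x; rewrite mem_filter => /= /andP[/negPf xa /two]; rewrite xa.
    move/all_pred1P => ->; congr nseq; rewrite size_filter.
    by rewrite -(count_predC (pred1 a.+1)) -/c addKn.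
  by rewrite size_filter.
have cn : (c < size ms)%N.
  rewrite -(count_predC (pred1 a.+1)) -/c -[X in (X < _)%N]addn0 ltn_add2l -has_count.
  by apply/hasP; exists a => //=; lia.
have sumE : sumn ms = (a * size ms + c)%N.
  by rewrite (perm_sumn pm) sumn_cat !sumn_nseq; nia.
rewrite sumE modnMDl modn_small // divnMDl // divn_small // addn0.
exact: pm.
Qed.

Lemma diag_dim_MK ms r : diag_dim (MK_blocks ms r) = (2 * sumn ms + size ms + 2 * r)%N.
Proof.
rewrite /MK_blocks diag_dim_cat diag_dim_nseq /=.
suff -> : diag_dim [seq @Mblk R i | i <- ms] = (2 * sumn ms + size ms)%N by lia.
by elim: ms => //= k ms ->; lia.
Qed.

(** Only the M-blocks have odd size. *)
Lemma diag_dim_parity (bs : seq skblock) : exists q, diag_dim bs = (count is_Mblk bs + 2 * q)%N.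
Proof.
elim: bs => [|b bs [q IH]] /=; first by exists 0%N.
by rewrite IH; case: b => [h mu|k|k] /=; [exists (h + q)%N|exists (k + q)%N|exists (k + q)%N]; lia.
Qed.

(** The sizes fix the outcome: after merging down to [n - 2w] M-blocks and [r]
    blocks [K_1], the indices of the M-blocks sum to [w - r], and balancing them
    gives the list of [W]. *)
Lemma degen_W_blocks n w r (bs : seq skblock) :
  (2 <= 2 * w <= n - 1)%N -> (r <= w)%N -> all skblock_valid bs ->
  diag_dim bs = n -> count is_Kblk bs = r -> (n - 2 * w <= count is_Mblk bs)%N ->
  degen_blocks bs (@W_blocks R n w r).
Proof.
move=> hw hr vbs dim cK cM.
have /hasP[b bbs] : has is_Mblk bs by rewrite has_count; lia.
case: b bbs => // k bbs _; have pm := perm_to_rem bbs; move: (rem _ _) pm => cs pm.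
have [|ms sz deg] := @degen_absorb cs k.
  by move: vbs; rewrite (perm_all _ pm) => /andP[].
have [q dq] := diag_dim_parity bs.
have /permP pmc := pm; move: cK cM dq; rewrite !pmc /= add0n add1n -sz => cK cM dq.
rewrite cK in deg.
have [|ms' sz' deg'] := @degen_merge3 (n - 2 * w).-1 ((size ms - (n - 2 * w))./2) ms r.
  have := odd_double_half (size ms - (n - 2 * w)); lia.
have {}sz' : size ms' = (n - 2 * w)%N by lia.
have sumE : sumn ms' = (w - r)%N.
  have [e _] := deg; have [e' _] := deg'; have [e2 _] := degen_blocks_perm pm.
  by rewrite -e2 in e; move: e' e; rewrite !diag_dim_MK sz'; lia.
apply: degen_blocks_trans (degen_blocks_perm pm) _.
apply: degen_blocks_trans deg _.
apply: degen_blocks_trans deg' _.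
have := @degen_balance ms' r; rewrite sz' sumE => /(_ ltac:(lia)) /=.
by rewrite /MK_blocks /W_blocks map_cat !map_nseq catA.
Qed.

End BlockLists.

(** * Rank and the number of M-blocks *)

Section BlockRank.
Context {R : realType}.
Local Notation C := R[i].
Local Notation skblock := (@skblock R).

Lemma rank_at_dsum m n p q (P : bool -> 'M[C]_(m, n)) (Q : bool -> 'M[C]_(p, q)) x :
  \rank (pencil_at (dsum P Q) x) = (\rank (pencil_at P x) + \rank (pencil_at Q x))%N.
Proof.
rewrite -rank_diag_block_mx; congr (\rank _).
by rewrite /pencil_at /dsum scale_block_mx opp_block_mx add_block_mx !scaler0 !oppr0 !addr0.
Qed.

(** Exchanging the two block columns makes the matrix block diagonal. *)
Lemma rank_at_skew_of m n (X : bool -> 'M[C]_(m, n)) x :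
  \rank (pencil_at (skew_of X) x) = (2 * \rank (pencil_at X x))%N.
Proof.
pose swap p q : 'M[C]_(p + q, q + p) := block_mx 0 1%:M 1%:M 0.
have swap_free : row_free (swap m n).
  apply/row_freeP; exists (swap n m).
  by rewrite /swap mulmx_block !(mul0mx, mulmx0, mulmx1, add0r, addr0) -scalar_mx_block.
rewrite -(mxrankMfree _ swap_free).
have -> : pencil_at (skew_of X) x *m swap m n = block_mx (pencil_at X x) 0 0 (- (pencil_at X x)^T).
  rewrite /pencil_at /skew_of scale_block_mx opp_block_mx add_block_mx mulmx_block.
  rewrite !(scaler0, oppr0, mul0mx, mulmx0, mulmx1, add0r, addr0).
  by rewrite [(_ - _)^T]linearB /= [(x *: _)^T]linearZ /= opprB scalerN opprK [- _ + _]addrC.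
by rewrite rank_diag_block_mx mxrank_opp mxrank_tr mul2n addnn.
Qed.

Lemma rank_diag_le (bs : seq skblock) x :
  (\rank (pencil_at (coefs (diag_pencil bs)) x) + count is_Mblk bs <= diag_dim bs)%N.
Proof.
elim: bs => [|b bs IH]; first by rewrite addn0 rank_leq_row.
rewrite /= coefs_dsum rank_at_dsum addnACA leq_add //.
case: b => [h mu|k|k] /=; rewrite ?addn0 ?rank_leq_row //.
rewrite coefs_M rank_at_skew_of addn1 mul2n -addnn addnS ltnS.
by rewrite leq_add ?rank_leq_row.
Qed.

Lemma unitmx_lower n (A : 'M[C]_n) :
  (forall i j : 'I_n, (i < j)%N -> A i j = 0) -> (forall i, A i i != 0) -> A \in unitmx.
Proof.
move=> A0 A1; rewrite unitmxE det_trig; last exact/is_trig_mxP.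
by rewrite unitfE; apply/prodf_neq0 => i _.
Qed.

Definition not_eigenvalue (x : C) (b : skblock) := if b is Hblk _ mu then x != mu else true.

(** Off the eigenvalues, the square blocks are triangular with nonzero diagonal,
    and so is [L_k] without its first column. *)
Lemma rank_diag_ge (bs : seq skblock) x : all (not_eigenvalue x) bs ->
  (diag_dim bs <= \rank (pencil_at (coefs (diag_pencil bs)) x) + count is_Mblk bs)%N.
Proof.
elim: bs => [|b bs IH] //= /andP[bx /IH {}IH].
rewrite coefs_dsum rank_at_dsum addnACA leq_add // {IH}.
case: b bx => [h mu|k|k] /= bx;
  rewrite ?coefs_H ?coefs_K ?coefs_M rank_at_skew_of mul2n -addnn ?addn0.
- suff e : \rank (pencil_at (Jpen mu h) x) = h by rewrite e.
  apply: mxrank_unit; rewrite -unitmx_tr; apply: unitmx_lower => [i j ij|i].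
    rewrite !mxE -!val_eqE /= (gtn_eqF ij) (_ : _ == _ = false); last by lia.
    by rewrite mulr0 subr0.
  by rewrite !mxE eqxx mulr1 subr_eq0.
- suff e : \rank (pencil_at (@Npen R k) x) = k by rewrite e.
  apply: mxrank_unit; rewrite -unitmx_tr; apply: unitmx_lower => [i j ij|i].
    rewrite !mxE -!val_eqE /= (gtn_eqF ij) (_ : _ == _ = false); last by lia.
    by rewrite mulr0 subr0.
  by rewrite !mxE eqxx mulr0 sub0r oppr_eq0 oner_eq0.
- suff e : (k <= \rank (pencil_at (Lpen (0%R : C) k) x))%N by lia.
  apply: (@minor_rank _ _ _ _ _ id (lift ord0)); rewrite -unitfE -unitmxE.
  apply: unitmx_lower => [i j ij|i]; rewrite !mxE /= /bump /=.
    have [-> ->] : ((1 + j)%N == i) = false /\ ((1 + j)%N == i.+1) = false.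
      by split; apply/eqP; move: ij; clear; lia.
    by rewrite !mulr0 addr0 subr0.
  have -> : ((1 + i)%N == i) = false by apply/eqP; lia.
  by rewrite eqxx mul0r mulr0 addr0 sub0r oppr_eq0 oner_eq0.
Qed.

Lemma exists_not_eigenvalue (bs : seq skblock) : exists x, all (not_eigenvalue x) bs.
Proof.
pose mus := [seq (if b is Hblk _ mu then mu else 0) | b <- bs].
have p0 : \prod_(a <- mus) ('X - a%:P) != 0 by rewrite monic_neq0 ?monic_prod_XsubC.
have [i xmus] := exists_nonroot p0 (@natr_inj C).
rewrite root_prod_XsubC in xmus; exists i%:R; apply/allP => -[h mu|//|//] bbs /=.
by apply: contraNneq xmus => ->; apply/mapP; exists (Hblk h mu).
Qed.

End BlockRank.

(** * The closure of the generic orbit *)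

Section Main.
Context {R : realType}.

Lemma degen_congr_pencil n (S : 'M[R[i]]_n) (Q : skew_pencil R n) :
  degen (coefs (congr_pencil S Q)) (coefs Q).
Proof. by apply: (@degen_congr _ _ _ _ _ S); case. Qed.

Lemma degen_congr_pencil_inv n (S : 'M[R[i]]_n) (Q : skew_pencil R n) : S \in unitmx ->
  degen (coefs Q) (coefs (congr_pencil S Q)).
Proof.
move=> Su; apply: (@degen_congr _ _ _ _ _ (invmx S)) => b.
have -> : coefs (congr_pencil S Q) b = S^T *m coefs Q b *m S by case: b.
rewrite -!mulmxA mulmxV // mulmx1 mulmxA -trmx_mul mulmxV // trmx1 mul1mx //.
Qed.

Lemma degen_cast m n p (e : m = n) (Q : skew_pencil R m) (T : skew_pencil R p) :
  (degen (coefs (cast_pencil e Q)) (coefs T) <-> degen (coefs Q) (coefs T)) /\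
  (degen (coefs T) (coefs (cast_pencil e Q)) <-> degen (coefs T) (coefs Q)).
Proof. by case: n / e. Qed.

Lemma count_W n w r : (2 <= 2 * w <= n - 1)%N ->
  count is_Mblk (@W_blocks R n w r) = (n - 2 * w)%N.
Proof.
move=> hw; rewrite /W_blocks !count_cat !count_nseq /=.
have := @ltn_pmod (w - r) (n - 2 * w); lia.
Qed.

End Main.

Theorem theorem2p4 (R : realType) (n w r : nat) (hn : (2 <= n)%N)
    (hw : (2 <= 2 * w <= n - 1)%N) (hr : (r <= w)%N) :
  let X := [set P : skew_pencil R n | (pencil_rank P <= 2 * w)%N /\ INF R n r P] in
  [/\ X `<=` INF R n r,
      closed (X : set (subspace (INF R n r)))
    & X = closure (congr_orbit (W_pencil R hw hr)) `&` INF R n r].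
Proof.
move=> X.
have XE : X = closure (congr_orbit (W_pencil R hw hr)) `&` INF R n r.
  apply/seteqP; split => P [].
    move=> rP infP; split=> //; apply/closure_orbitP.
    have [bs [vbs [e [S Su PE]]] cK] := infP.
    have Pbs : degen (coefs P) (coefs (diag_pencil bs)).
      by rewrite PE; apply: degen_trans (degen_congr_pencil _ _) _;
        apply/(degen_cast e _ _).1; exact: degen_refl.
    have bsP : degen (coefs (diag_pencil bs)) (coefs P).
      by rewrite PE; apply: degen_trans (degen_congr_pencil_inv _ Su);
        apply/(degen_cast e _ _).2; exact: degen_refl.
    have [x /rank_diag_ge bsx] := exists_not_eigenvalue bs.
    have cM : (n - 2 * w <= count is_Mblk bs)%N.
      have := leq_trans (degen_rank x bsP) (leq_trans (rank_at_le P x) rP); lia.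
    have [_ bsW] := degen_W_blocks hw hr vbs e cK cM.
    by apply/(degen_cast _ _ _).2; exact: degen_trans bsW.
  move=> /closure_orbitP PW infP; split=> //; apply: pencil_rank_le => x.
  have {}PW : degen (coefs P) (coefs (diag_pencil (@W_blocks R n w r))).
    by move/(degen_cast _ _ _).2: PW.
  have := rank_diag_le (@W_blocks R n w r) x; have := degen_rank x PW.
  rewrite count_W //; have := @W_dim R _ _ _ hw hr; lia.
split=> //; first by move=> P [].
apply/closed_subspaceP; exists (closure (congr_orbit (W_pencil R hw hr))).
  exact: closed_closure.
by rewrite XE -setIA setIid.
Qed.
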